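(* We have $$\mathcal{D}^{(2)}_{2\bar\Lambda_0}(z,q)=\sum_{r_1,r_2,s_1,s_2\geq 0}\ \prod_{i=1}^2\frac{z^{r_i+s_i}q^{(r_i+s_i)^2+s_i^2+r_i+2s_i}}{(q;q)_{r_i-r_{i+1}}(q^2;q^2)_{s_i-s_{i-1}}},$$ $$\mathcal{D}^{(2)}_{2\bar\Lambda_1}(z,q)=\sum_{r_1,r_2,s_1,s_2\geq 0}\ \prod_{i=1}^2\frac{z^{r_i+s_i}q^{(r_i+s_i)^2+s_i^2}}{(q;q)_{r_i-r_{i+1}}(q^2;q^2)_{s_i-s_{i-1}}},$$ $$\mathcal{D}^{(2)}_{\bar\Lambda_0+\bar\Lambda_1}(z,q)=\sum_{r_1,r_2,s_1,s_2\geq 0}\Big(1+zq^{2+\sum_{i=1}^2(r_i+2s_i)}\Big)\prod_{i=1}^2\frac{z^{r_i+s_i}q^{(r_i+s_i)^2+s_i^2+\delta_{i,2}(r_i+2s_i)}}{(q;q)_{r_i-r_{i+1}}(q^2;q^2)_{s_i-s_{i-1}}},$$ $$\mathcal{D}^{(2)}_{\bar\Lambda_0+\bar\Lambda_2}(z,q)=\sum_{r_1,r_2,s_1,s_2\geq 0}\Big(1+zq^{2+\sum_{i=1}^2(r_i+2s_i)}\Big)\prod_{i=1}^2\frac{z^{r_i+s_i}q^{(r_i+s_i)^2+s_i^2+r_i+2\delta_{i,2}s_i}}{(q;q)_{r_i-r_{i+1}}(q^2;q^2)_{s_i-s_{i-1}}},$$ where $r_3=s_0:=0$ and $\delta_{i,j}$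 is the Kronecker delta.
   Context: Notation: $(a;q)_n=(a;q)_\infty/(aq^n;q)_\infty$ with $(a;q)_\infty=\prod_{j\geq0}(1-aq^j)$, so $(q;q)_n=\prod_{j=1}^n(1-q^j)$ for $n\geq0$ and $1/(q;q)_n:=0$ for negative integers $n$ (similarly for base $q^2$); hence only terms with $r_1\geq r_2$ and $s_1\leq s_2$ contribute. Identities are between formal power series. Consider $3$-coloured partitions $\lambda$: finite multisets of parts, each a positive integer $i$ (size) with a colour $c\in\{1,2,3\}$, such that all parts of colour $2$ are odd and all parts of colours $1$ and $3$ are even. Let $f_i^{(c)}$ be the multiplicity of parts of size $i\geq1$ and colour $c$, $|\lambda|=\sum_{i,c}if_i^{(c)}$, $l(\lambda)=\sum_{i,c}f_i^{(c)}$. Given nonnegative integers $k_0,k_1,k_2$ put $f_0^{(1)}:=k_0$, $f_{-1}^{(2)}:=k_1$, $f_0^{(3)}:=k_2$. A path is a triple $(p_1,p_2,p_3)=(f^{(1)}_{i_1},f^{(2)}_{i_2},f^{(3)}_{i_3})$ with $i_1,i_3\in\{0,2,4,\dots\}$, $i_2\in\{-1,1,3,\dots\}$ and $|i_1-i_2|=|i_2-i_3|=1$. Let $\mathscr{D}_{k_0,k_1,k_2}$ be the set of such coloured partitions with $p_1+p_2+p_3\leq k_0+k_1+k_2$ for all paths, and define $$\mathcal{D}^{(2)}_{k_0\bar\Lambda_0+k_1\bar\Lambda_1+k_2\bar\Lambda_2}(z,q):=\sum_{\lambda\in\mathscr{D}_{k_0,k_1,k_2}}z^{l(\lambda)}q^{|\lambda|}.$$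 The symbols $\bar\Lambda_0,\bar\Lambda_1,\bar\Lambda_2$ (scaled fundamental weights of $\mathrm{D}^{(2)}_3$) only serve to index the triple $(k_0,k_1,k_2)$. *)

(* Defs.v *)
From HB Require Import structures.
From mathcomp Require Import all_boot all_order all_algebra.
From mathcomp Require Import finmap multiset.
From mathcomp Require Import boolp classical_sets functions cardinality fsbigop.

Set Implicit Arguments.
Unset Strict Implicit.
Unset Printing Implicit Defensive.

Import GRing.Theory.

Local Open Scope ring_scope.

(* Formal power series in one variable over R. *)
Record fps (R : Type) := Fps { coefs : nat -> R }.

HB.instance Definition _ (R : Type) := gen_eqMixin (fps R).
HB.instance Definition _ (R : Type) := gen_choiceMixin (fps R).

Lemma fpsP (R : Type) (f g : fps R) : coefs f =1 coefs g -> f = g.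
Proof. by case: f g => [f] [g] /= fg; congr Fps; apply/funext. Qed.

Section FpsRing.
Variable R : comNzRingType.
Implicit Types f g h : fps R.

Definition fps0 : fps R := Fps (fun=> 0).
Definition fps_opp f : fps R := Fps (fun n => - coefs f n).
Definition fps_add f g : fps R := Fps (fun n => coefs f n + coefs g n).

Fact fps_addA : associative fps_add.
Proof. by move=> f g h; apply: fpsP => n /=; rewrite addrA. Qed.
Fact fps_addC : commutative fps_add.
Proof. by move=> f g; apply: fpsP => n /=; rewrite addrC. Qed.
Fact fps_add0 : left_id fps0 fps_add.
Proof. by move=> f; apply: fpsP => n /=; rewrite add0r. Qed.
Fact fps_addN : left_inverse fps0 fps_opp fps_add.
Proof. by move=> f; apply: fpsP => n /=; rewrite addNr. Qed.

HB.instance Definition _ :=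
  GRing.isZmodule.Build (fps R) fps_addA fps_addC fps_add0 fps_addN.

Definition fpsC (c : R) : fps R := Fps (fun n => if n == 0%N then c else 0).
Definition fpsX : fps R := Fps (fun n => (n == 1%N)%:R).
Definition fps_mul f g : fps R :=
  Fps (fun n => \sum_(i < n.+1) coefs f i * coefs g (n - i)%N).

Definition fps_trunc m f : {poly R} := \poly_(i < m.+1) coefs f i.

Lemma coef_fps_trunc m f i :
  (fps_trunc m f)`_i = if (i <= m)%N then coefs f i else 0.
Proof. by rewrite coef_poly ltnS. Qed.

Lemma coef_fps_mul m f g n : (n <= m)%N ->
  coefs (fps_mul f g) n = (fps_trunc m f * fps_trunc m g)`_n.
Proof.
move=> lenm; rewrite coefM /=; apply: eq_bigr => i _.
rewrite !coef_fps_trunc (leq_trans _ lenm) ?(leq_trans (leq_subr _ _) lenm) //.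
by rewrite -ltnS.
Qed.

Lemma eq_coefM (p p' r r' : {poly R}) n :
    (forall i, (i <= n)%N -> p`_i = p'`_i) ->
    (forall i, (i <= n)%N -> r`_i = r'`_i) ->
  (p * r)`_n = (p' * r')`_n.
Proof.
move=> pp' rr'; rewrite !coefM; apply: eq_bigr => i _.
by rewrite pp' -1?ltnS // rr' // leq_subr.
Qed.

Lemma coef_trunc_mul n f g i : (i <= n)%N ->
  (fps_trunc n (fps_mul f g))`_i = (fps_trunc n f * fps_trunc n g)`_i.
Proof. by move=> lein; rewrite coef_fps_trunc lein (coef_fps_mul _ _ lein). Qed.

Fact fps_mulC : commutative fps_mul.
Proof. by move=> f g; apply: fpsP => n; rewrite !(@coef_fps_mul n) // mulrC. Qed.

Fact fps_mulA : associative fps_mul.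
Proof.
move=> f g h; apply: fpsP => n; rewrite !(@coef_fps_mul n) //.
rewrite (@eq_coefM _ (fps_trunc n f) _ (fps_trunc n g * fps_trunc n h)) //;
  last exact: coef_trunc_mul.
rewrite mulrA; apply: eq_coefM => // i lein.
by rewrite coef_trunc_mul.
Qed.

Fact fps_mul1 : left_id (fpsC 1) fps_mul.
Proof.
move=> f; apply: fpsP => n /=; rewrite big_ord_recl /= mul1r subn0.
by rewrite big1 ?addr0 // => i _; rewrite mul0r.
Qed.

Fact fps_mulDl : left_distributive fps_mul fps_add.
Proof.
move=> f g h; apply: fpsP => n /=; rewrite -big_split /=.
by apply: eq_bigr => i _; rewrite mulrDl.
Qed.

Fact fps_1neq0 : fpsC 1 != 0.
Proof.
by apply/eqP => /(congr1 (fun f => coefs f 0)) /= /eqP; rewrite oner_eq0.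
Qed.

HB.instance Definition _ := GRing.Zmodule_isComNzRing.Build (fps R)
  fps_mulA fps_mulC fps_mul1 fps_mulDl fps_1neq0.

Lemma coef_fpsD f g n : coefs (f + g) n = coefs f n + coefs g n.
Proof. by []. Qed.
Lemma coef_fpsN f n : coefs (- f) n = - coefs f n.
Proof. by []. Qed.
Lemma coef_fps0 n : coefs (0 : fps R) n = 0.
Proof. by []. Qed.
Lemma coef_fps1 n : coefs (1 : fps R) n = (n == 0%N)%:R.
Proof. by case: n. Qed.
Lemma coef_fpsM f g n :
  coefs (f * g) n = \sum_(i < n.+1) coefs f i * coefs g (n - i)%N.
Proof. by []. Qed.
Lemma coef_fps_sum (I : Type) (s : seq I) (P : pred I) (F : I -> fps R) n :
  coefs (\sum_(i <- s | P i) F i) n = \sum_(i <- s | P i) coefs (F i) n.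
Proof. by elim/big_rec2: _ => // i x y _ <-. Qed.

Lemma coef_fps_exp_small f m n : coefs f 0 = 0 -> (n < m)%N ->
  coefs (f ^+ m) n = 0.
Proof.
move=> f0; elim: m n => // m IHm n ltnm.
rewrite exprS coef_fpsM big_ord_recl f0 mul0r add0r big1 // => i _.
rewrite IHm ?mulr0 //= /bump /=.
by case: n i ltnm => [[] //|n] i ltnm; rewrite add1n subSS (leq_ltn_trans (leq_subr _ _)).
Qed.

End FpsRing.

Section FpsUnit.
Variable R : comUnitRingType.
Implicit Types f g : fps R.

Definition fps_unit : {pred fps R} := fun f => coefs f 0 \is a GRing.unit.

(* With u = 1 - f / f(0), which has no constant term, 1 / f is              *)
(* (1 / f(0)) * (1 + u + u ^ 2 + ...); powers of u beyond n do not reach    *)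
(* degree n.                                                                *)
Definition fps_inv f : fps R :=
  if f \in fps_unit then
    let u := 1 - fpsC (coefs f 0)^-1 * f in
    Fps (fun n => (coefs f 0)^-1 * coefs (\sum_(m < n.+1) u ^+ m) n)
  else f.

Lemma coef_fpsCM (c : R) f n : coefs (fpsC c * f) n = c * coefs f n.
Proof.
rewrite coef_fpsM big_ord_recl /= subn0 big1 ?addr0 // => i _.
by rewrite mul0r.
Qed.

Fact fps_mulVf : {in fps_unit, left_inverse 1 fps_inv *%R}.
Proof.
move=> f Uf; rewrite /fps_inv Uf; set c := (coefs f 0)^-1.
set u := 1 - fpsC c * f.
have u0 : coefs u 0 = 0.
  by rewrite coef_fpsD coef_fpsN coef_fpsCM mulVr // coef_fps1 subrr.
apply: fpsP => n; rewrite coef_fpsM /=.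
transitivity (coefs ((\sum_(m < n.+1) u ^+ m) * (fpsC c * f)) n).
  rewrite mulrCA coef_fpsCM coef_fpsM mulr_sumr; apply: eq_bigr => -[i /= lein] _.
  rewrite -mulrA; congr (_ * (_ * _)).
  rewrite !coef_fps_sum (big_ord_widen _ (fun m => coefs (u ^+ m) i) lein).
  rewrite big_mkcond /=; apply: eq_bigr => m _; case: ifPn => //.
  by rewrite -leqNgt => ltim; rewrite coef_fps_exp_small.
have -> : fpsC c * f = 1 - u by rewrite /u opprB addrC subrK.
rewrite [X in coefs X n]mulrC.
have -> : (1 - u) * (\sum_(m < n.+1) u ^+ m) = 1 - u ^+ n.+1.
  by apply: oppr_inj; rewrite -mulNr !opprB subrX1.
by rewrite coef_fpsD coef_fpsN coef_fps_exp_small // subr0.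
Qed.

Fact fps_unitPl f g : g * f = 1 -> fps_unit f.
Proof.
move=> /(congr1 (fun h => coefs h 0)); rewrite coef_fpsM big_ord1 coef_fps1 /=.
by move=> gf1; apply/unitrPr; exists (coefs g 0); rewrite mulrC.
Qed.

Fact fps_inv_out : {in [predC fps_unit], fps_inv =1 id}.
Proof. by move=> f; rewrite inE /fps_inv => /negPf ->. Qed.

HB.instance Definition _ := GRing.ComNzRing_hasMulInverse.Build (fps R)
  fps_mulVf fps_unitPl fps_inv_out.

End FpsUnit.

Arguments fpsX {R}.

(* Z[[z, q]], realised as Z[[q]][[z]]: the coefficient of z ^ l q ^ n in f  *)
(* is coefs (coefs f l) n.                                                  *)
Notation zq_series := (fps (fps int)).

Definition varz : zq_series := fpsX.
Definition varq : zq_series := fpsC fpsX.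

(* Formal sum of a family of series, coefficient by coefficient; in each of *)
(* the sums below only finitely many terms contribute to a given            *)
(* coefficient.                                                             *)
Definition formal_sum (I : choiceType) (A : set I) (F : I -> zq_series) :
    zq_series :=
  Fps (fun l => Fps (fun n => \sum_(i \in A) coefs (coefs (F i) l) n)).

(* (a; q)_n for n >= 0. *)
Definition qpoch (R : nzRingType) (a q : R) (n : nat) : R :=
  \prod_(0 <= j < n) (1 - a * q ^+ j).

(* 1 / (q; q)_n, which is 0 for negative n. *)
Definition inv_qpoch (R : comUnitRingType) (q : R) (n : int) : R :=
  if n is Posz m then (qpoch q q m)^-1 else 0.

(* A part is a pair (size, colour), and a coloured partition is a finite    *)
(* multiset of parts.                                                       *)
Definition part : choiceType := (nat * nat)%type.
Notation partition3 := {mset part}%mset.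

Definition is_part (p : part) : Prop :=
  (1 <= p.1)%N /\ ((p.2 = 2%N /\ odd p.1) \/
                   ((p.2 = 1%N \/ p.2 = 3%N) /\ ~~ odd p.1)).

Definition is_partition3 (la : partition3) : Prop :=
  forall p : part, p \in la -> is_part p.

Definition weight (la : partition3) : nat := (\sum_(p <- la) p.1)%N.
Definition length (la : partition3) : nat := size la.

(* f_i^(c), including the boundary values f_0^(1), f_{-1}^(2), f_0^(3). *)
Definition freq (k0 k1 k2 : nat) (la : partition3) (c : nat) (i : int) : nat :=
  if (c == 1%N) && (i == 0) then k0
  else if (c == 2%N) && (i == -1) then k1
  else if (c == 3%N) && (i == 0) then k2
  else if i is Posz m then la (m, c) else 0%N.

Definition is_path (i1 i2 i3 : int) : Prop :=
  [/\ 0 <= i1 /\ (2 %| i1)%Z, -1 <= i2 /\ ~~ (2 %| i2)%Z, 0 <= i3 /\ (2 %| i3)%Z,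
      `|i1 - i2| = 1 & `|i2 - i3| = 1].

Definition Dset (k0 k1 k2 : nat) : set partition3 :=
  fun la => is_partition3 la /\
    forall i1 i2 i3 : int, is_path i1 i2 i3 ->
      (freq k0 k1 k2 la 1 i1 + freq k0 k1 k2 la 2 i2 + freq k0 k1 k2 la 3 i3
         <= k0 + k1 + k2)%N.

Definition Dseries (k0 k1 k2 : nat) : zq_series :=
  formal_sum (Dset k0 k1 k2)
    (fun la => varz ^+ length la * varq ^+ weight la).

(* The sequence a_1, a_2 extended by a_0 = a_3 = 0. *)
Definition ext2 (a : nat * nat) (i : nat) : nat :=
  nth 0%N [:: 0%N; a.1; a.2] i.

(* Sum over r_1, r_2, s_1, s_2 >= 0. *)
Definition sum_rs (F : (nat -> nat) -> (nat -> nat) -> zq_series) : zq_series :=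
  formal_sum [set: (nat * nat) * (nat * nat)]
    (fun rs => F (ext2 rs.1) (ext2 rs.2)).

(* Main.v *)
Require Import Defs.
From mathcomp Require Import all_boot all_order all_algebra.
From mathcomp Require Import finmap multiset zify ring.
From mathcomp Require Import boolp classical_sets functions cardinality fsbigop.

(* Cut a path-bounded coloured partition after its parts of size at most 2.
   If G_(a,b) is the series of Dset a (2 - a - b) b, the multiplicities a', c,
   b' of (2, colour 1), (1, colour 2), (2, colour 3) are constrained only by
   max(a, a') + c + max(b, b') <= 2, and the remaining parts, lowered by 2, form
   a partition counted by G_(a',b').  Hence
     G_(a,b)(z) = sum z^(a'+c+b') q^(c+2a'+2b') G_(a',b')(z q^2),
   a system which, with the constant terms in z, determines the G_(a,b).
   On the other side let F(a1,a2,b1,b2) be the sum over r, s with the extra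
   linear exponent a1 r1 + a2 r2 + b1 s1 + b2 s2.  Multiplying the summand by
   1 - q^m, where m is one of r1 - r2, r2, 2 s1, 2 (s2 - s1), and shifting that
   index gives four families of contiguous relations; the system for the
   right-hand sides is a linear combination of finitely many of them. *)

Set Implicit Arguments.
Unset Strict Implicit.
Unset Printing Implicit Defensive.

Import GRing.Theory.
Local Open Scope ring_scope.

(** * Formal power series and formal sums *)

Section Fps.
Variable R : comUnitRingType.
Implicit Types f g : fps R.

Lemma coef_fpsXnM i f l :
  coefs (fpsX ^+ i * f) l = if (i <= l)%N then coefs f (l - i)%N else 0.
Proof.
elim: i l => [|i IHi] l; first by rewrite expr0 mul1r subn0.
rewrite exprS -mulrA; move: (fpsX ^+ i * f) IHi => g IHi.
rewrite coef_fpsM; case: l => [|l]; first by rewrite big_ord1 mul0r.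
rewrite !big_ord_recl mul0r add0r mul1r big1 ?addr0 => [|k _].
  by rewrite IHi ltnS lift0 subSS subn0.
by rewrite mul0r.
Qed.

Lemma fpsCM (a b : R) : fpsC (a * b) = fpsC a * fpsC b.
Proof. by apply: fpsP => -[|n]; rewrite coef_fpsCM //= mulr0. Qed.

Lemma fpsCX (a : R) n : fpsC (a ^+ n) = fpsC a ^+ n.
Proof. by elim: n => // n IHn; rewrite !exprS fpsCM IHn. Qed.

Lemma fps_unitE f :
  (f \is a GRing.unit) = (coefs f 0 \is a GRing.unit).
Proof. by []. Qed.

Lemma fpsCV (a : R) :
  a \is a GRing.unit -> fpsC a^-1 = (fpsC a)^-1.
Proof.
move=> Ua; have Uf : fpsC a \is a GRing.unit by [].
by apply: (mulrI Uf); rewrite divrr // -fpsCM divrr.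
Qed.

Lemma fpsCB (a b : R) : fpsC (a - b) = fpsC a - fpsC b.
Proof. by apply: fpsP => -[|n]; rewrite coef_fpsD coef_fpsN //= subr0. Qed.

End Fps.

Lemma coef_monM i j (f : zq_series) l n :
  coefs (coefs (varz ^+ i * varq ^+ j * f) l) n =
  if (i <= l)%N && (j <= n)%N then coefs (coefs f (l - i)%N) (n - j)%N else 0.
Proof.
rewrite -mulrA coef_fpsXnM; case: leqP => // _.
by rewrite /varq -fpsCX coef_fpsCM coef_fpsXnM.
Qed.

Lemma coef_mon i j l n :
  coefs (coefs (varz ^+ i * varq ^+ j) l) n = ((l == i) && (n == j))%:R.
Proof.
rewrite -[varz ^+ i * _]mulr1 coef_monM coef_fps1.
have -> : (l == i) && (n == j) =
    (i <= l)%N && (j <= n)%N && ((l - i == 0)%N && (n - j == 0)%N) by lia.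
by case: ifP => // _; case: (_ == _)%N; rewrite ?coef_fps1.
Qed.

(* The substitution z -> z q ^ 2. *)
Definition zshift (f : zq_series) : zq_series :=
  Fps (fun l => fpsX ^+ (2 * l) * coefs f l).

Lemma coef_zshift f l n : coefs (coefs (zshift f) l) n =
  if (2 * l <= n)%N then coefs (coefs f l) (n - 2 * l)%N else 0.
Proof. exact: coef_fpsXnM. Qed.

Lemma zshiftD f g : zshift (f + g) = zshift f + zshift g.
Proof. by apply: fpsP => l; rewrite /= mulrDr. Qed.

Lemma zshiftM_mon i j f :
  zshift (varz ^+ i * varq ^+ j * f) =
  varz ^+ i * varq ^+ (j + 2 * i) * zshift f.
Proof.
apply: fpsP => l; apply: fpsP => n.
rewrite coef_monM !coef_zshift coef_monM.
set c := fun b => coefs (coefs f (l - i)%N) b; rewrite -!/(c _).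
do !case: ifP => ? //; try lia; congr c; lia.
Qed.

Lemma zshiftC a : zshift (fpsC a) = fpsC a.
Proof. by apply: fpsP => -[|l]; rewrite /= ?expr0 ?mul1r ?mulr0. Qed.

Lemma zshift_mon i j :
  zshift (varz ^+ i * varq ^+ j) = varz ^+ i * varq ^+ (j + 2 * i).
Proof.
by rewrite -[LHS](congr1 zshift (mulr1 _)) zshiftM_mon (zshiftC 1) mulr1.
Qed.

Section FormalSum.
Context {I : choiceType}.
Implicit Types (A B : set I) (F G : I -> zq_series).
Local Open Scope classical_set_scope.

(** A finitely supported sum takes the value 0 on a family of infinite support, so formal sums add
    up and split along fibres only once each coefficient is known to receive finitely many nonzero
    contributions. *)
Definition locally_finite A F := forall l n,
  finite_set (A `&` [set i | coefs (coefs (F i) l) n <> 0]).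

Lemma formal_sumE A F l n : coefs (coefs (formal_sum A F) l) n =
  \sum_(i \in A) coefs (coefs (F i) l) n.
Proof. by []. Qed.

Lemma eq_formal_sum A F G : (forall i, A i -> F i = G i) ->
  formal_sum A F = formal_sum A G.
Proof.
move=> FG; apply: fpsP => l; apply: fpsP => n; rewrite !formal_sumE.
by apply: eq_fsbigr => i; rewrite inE => /FG ->.
Qed.

Lemma formal_sumD A F G : locally_finite A F -> locally_finite A G ->
  formal_sum A (fun i => F i + G i) = formal_sum A F + formal_sum A G.
Proof.
move=> fF fG; apply: fpsP => l; apply: fpsP => n.
rewrite !coef_fpsD !formal_sumE.
(* The two supports need not agree; over their union all three sums become sums on one finite
   set. *)
pose S := (A `&` [set i | coefs (coefs (F i) l) n <> 0]) `|`
          (A `&` [set i | coefs (coefs (G i) l) n <> 0]).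
have fS : finite_set S by rewrite finite_setU; split; [exact: fF|exact: fG].
have SA : S `<=` A by move=> i [[]|[]].
have nS i : A i -> ~ S i ->
    coefs (coefs (F i) l) n = 0 /\ coefs (coefs (G i) l) n = 0.
  by move=> Ai nSi; split; apply: contrapT => nz; apply: nSi; [left|right].
rewrite -!(fsbig_widen _ _ _ SA); first exact: fsbig_split.
- by move=> i [Ai /(nS _ Ai)[]].
- by move=> i [Ai /(nS _ Ai)[]].
- by move=> i [Ai /(nS _ Ai)[f0 g0]] /=; rewrite f0 g0 addr0.
Qed.

Lemma formal_sum_mon A F i j :
  formal_sum A (fun x => varz ^+ i * varq ^+ j * F x) =
  varz ^+ i * varq ^+ j * formal_sum A F.
Proof.
apply: fpsP => l; apply: fpsP => n; rewrite coef_monM formal_sumE.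
under eq_fsbigr => x _ do rewrite coef_monM.
by case: ifP => // _; rewrite fsbig1.
Qed.

Lemma locally_finite_mon A F i j : locally_finite A F ->
  locally_finite A (fun x => varz ^+ i * varq ^+ j * F x).
Proof.
move=> fF l n; apply: sub_finite_set (fF (l - i)%N (n - j)%N).
by move=> x [Ax /=]; rewrite coef_monM; case: ifP.
Qed.

Lemma formal_sum_zshift A F :
  formal_sum A (fun x => zshift (F x)) = zshift (formal_sum A F).
Proof.
apply: fpsP => l; apply: fpsP => n; rewrite coef_fpsXnM !formal_sumE.
under eq_fsbigr => x _ do rewrite coef_fpsXnM.
by case: ifP => // _; rewrite fsbig1.
Qed.

Lemma formal_sumN A F : formal_sum A (fun i => - F i) = - formal_sum A F.
Proof.
apply: fpsP => l; apply: fpsP => n.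
rewrite !coef_fpsN !formal_sumE -mulN1r mulr_fsumr.
by under [RHS]eq_fsbigr do rewrite mulN1r.
Qed.

End FormalSum.

Lemma formal_sum_image (I J : choiceType) (A : set I) (B : set J) (h : I -> J)
    (F : J -> zq_series) :
    set_bij A B h -> formal_sum B F = formal_sum A (F \o h).
Proof.
move=> Ah; apply: fpsP => l; apply: fpsP => n; rewrite !formal_sumE.
exact: reindex_fsbig Ah.
Qed.

Lemma formal_sum_widen (I : choiceType) (A B : set I) (F : I -> zq_series) :
  (A `<=` B)%classic -> (forall i, B i -> ~ A i -> F i = 0) ->
  formal_sum A F = formal_sum B F.
Proof.
move=> AB F0; apply: fpsP => l; apply: fpsP => n; rewrite !formal_sumE.
by apply: fsbig_widen => // i [Bi nAi] /=; rewrite F0.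
Qed.

(** This serves both changes of index: the shift by one in the contiguous relations, where a factor
    1 - q^k kills the missed terms, and the passage from r, s to their differences, where 1/(q;q)_n
    with negative n does. *)
Lemma formal_sum_inj (I J : choiceType) (h : I -> J) (F : J -> zq_series) :
    injective h -> (forall j, ~ (exists i, h i = j) -> F j = 0) ->
  formal_sum setT F = formal_sum setT (F \o h).
Proof.
move=> hI F0.
rewrite -(@formal_sum_widen _ (range h)) //.
  apply: formal_sum_image; split; first by move=> i _; exists i.
    by move=> x y _ _; exact: hI.
  by move=> j [i _ <-]; exists i.
by move=> j _ nj; apply: F0 => -[i hij]; apply: nj; exists i.
Qed.

Lemma formal_sum_fibers (I : choiceType) (T : finType) (A : set I)
    (h : I -> T) (F : I -> zq_series) : locally_finite A F ->
  formal_sum A F =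
  \sum_(t : T) formal_sum (A `&` [set i | h i = t])%classic F.
Proof.
move=> fF; apply: fpsP => l; apply: fpsP => n.
rewrite !coef_fps_sum !formal_sumE.
under [RHS]eq_bigr do rewrite formal_sumE fsbig_mkcondr.
pose S := (A `&` [set i | coefs (coefs (F i) l) n <> 0])%classic.
have SA : (S `<=` A)%classic by move=> i [].
have nS i : (A `\` S)%classic i -> coefs (coefs (F i) l) n = 0.
  by move=> [Ai nSi]; apply: contrapT => nz; apply: nSi.
(* The full sum and its restriction to each fibre all reduce to the same finite list, so the
   exchange below is one of finite sums. *)
have sumS (f : I -> int) : (forall i, (A `\` S)%classic i -> f i = 0) ->
    \sum_(i \in A) f i = \sum_(i <- fset_set S) f i.
  by move=> f0; rewrite -(fsbig_widen _ _ _ SA) // fsbig_finite //; exact: fF.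
rewrite sumS //; under eq_bigr => t _.
  rewrite sumS; last by move=> i /nS ->; rewrite if_same.
  over.
rewrite exchange_big /=; apply: eq_bigr => i _.
rewrite (bigD1 (h i)) //= big1 ?addr0 => [|t nt].
  by rewrite ifT // inE.
by rewrite ifF //; apply/negP; rewrite inE /= => ht; rewrite ht eqxx in nt.
Qed.

Lemma coef0_formal_sum (I : choiceType) (A : set I) (F : I -> zq_series) i0 :
    A i0 -> (forall i, A i -> i <> i0 -> coefs (F i) 0 = 0) ->
  coefs (formal_sum A F) 0 = coefs (F i0) 0.
Proof.
move=> Ai0 F0; apply: fpsP => n; rewrite formal_sumE.
rewrite -(@fsbig_widen _ _ _ _ [set i0]%classic); first by rewrite fsbig_set1.
- by move=> _ ->.
- by move=> i [Ai ni0] /=; rewrite F0.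
Qed.

(** * The transfer system and the contiguous relations *)

(* (a', c, b') are the multiplicities of (2, 1), (1, 2), (2, 3), and (a, b)
   those of (0, 1), (0, 3). *)
Definition admissible (a b : nat) (t : 'I_3 * 'I_3 * 'I_3) :=
  let: (a', c, b') := t in (maxn a a' + c + maxn b b' <= 2)%N.

Lemma sum_admissible (V : zmodType) a b (f : nat -> nat -> nat -> V) :
  \sum_(t | admissible a b t) f t.1.1 t.1.2 t.2 =
  \sum_(i < 3) \sum_(c < 3) \sum_(j < 3)
    if (maxn a i + c + maxn b j <= 2)%N then f i c j else 0.
Proof.
by rewrite big_mkcond !pair_bigA; apply: eq_bigr => -[[i c] j].
Qed.

(** The six boundary pairs with a + b <= 2 are enumerated so that the transfer system becomes a set
    of explicit polynomial identities. *)
Lemma sum_admissible_le2 (V : zmodType) (f : nat -> nat -> nat -> V) :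
  let S a b := \sum_(t | admissible a b t) f t.1.1 t.1.2 t.2 in
  [/\ [/\ S 0 0 = f 0 0 0 + f 0 0 1 + f 0 0 2 + f 0 1 0 + f 0 1 1 + f 0 2 0 +
                 f 1 0 0 + f 1 0 1 + f 1 1 0 + f 2 0 0,
           S 1 0 = f 0 0 0 + f 0 0 1 + f 0 1 0 + f 1 0 0 + f 1 0 1 + f 1 1 0 +
                 f 2 0 0
         & S 0 1 = f 0 0 0 + f 0 0 1 + f 0 0 2 + f 0 1 0 + f 0 1 1 + f 1 0 0 +
                 f 1 0 1],
      S 1 1 = f 0 0 0 + f 0 0 1 + f 1 0 0 + f 1 0 1,
      S 2 0 = f 0 0 0 + f 1 0 0 + f 2 0 0
    & S 0 2 = f 0 0 0 + f 0 0 1 + f 0 0 2].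
Proof.
split; [split|..]; rewrite sum_admissible.
all: rewrite !big_ord_recl !big_ord0 /= ?big_ord_recl ?big_ord0 /=.
all: by rewrite /bump /= ?addn0 ?add1n ?(addr0, add0r) ?addrA.
Qed.

Definition transfer_term (X : nat -> nat -> zq_series)
    (t : 'I_3 * 'I_3 * 'I_3) : zq_series :=
  let: (a', c, b') := t in
  varz ^+ (c + a' + b') * varq ^+ (c + 2 * (a' + b')) * zshift (X a' b').

Definition transfer (X : nat -> nat -> zq_series) (a b : nat) : zq_series :=
  \sum_(t | admissible a b t) transfer_term X t.

(** Strong induction on the degree in z, for all pairs (a, b) at once. In positive degree, only the
    value at (0, 0) enters the equations in that same degree, and with a factor that makes it
    solvable. *)
Lemma transfer_unique (X Y : nat -> nat -> zq_series) :
    (forall a b, (a + b <= 2)%N -> X a b = transfer X a b) ->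
    (forall a b, (a + b <= 2)%N -> Y a b = transfer Y a b) ->
    (forall a b, (a + b <= 2)%N -> coefs (X a b) 0 = coefs (Y a b) 0) ->
  forall a b, (a + b <= 2)%N -> X a b = Y a b.
Proof.
move=> eqX eqY XY0.
suff XY l a b : (a + b <= 2)%N -> coefs (X a b) l = coefs (Y a b) l.
  by move=> a b ab; apply: fpsP => l; exact: XY.
elim/ltn_ind: l a b => -[|l] IHl a b ab; first exact: XY0.
pose t0 : 'I_3 * 'I_3 * 'I_3 := (ord0, ord0, ord0).
have term0 Z : transfer_term Z t0 = zshift (Z 0%N 0%N).
  by rewrite -[RHS]mul1r -[1 in RHS]mul1r.
(* Every term but the one of (0, 0, 0) has a factor z. *)
have step a' b' : (a' + b' <= 2)%N ->
    coefs (X a' b') l.+1 - coefs (Y a' b') l.+1 =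
    fpsX ^+ (2 * l.+1) * (coefs (X 0%N 0%N) l.+1 - coefs (Y 0%N 0%N) l.+1).
  move=> ab'; rewrite eqX // eqY //.
  have adm0 : admissible a' b' t0 by rewrite /admissible /=; lia.
  rewrite /transfer !(bigD1 t0 adm0) !coef_fpsD !coef_fps_sum.
  rewrite (eq_bigr (fun t => coefs (transfer_term Y t) l.+1)).
    by rewrite opprD addrACA subrr addr0 !term0 mulrBr.
  move=> [[u c] v] /andP[adm nt0]; apply: fpsP => n; rewrite !coef_monM.
  case: ifP => // /andP[le_l _]; rewrite !coef_zshift.
  case: ifP => // _; rewrite IHl //; last by move: adm; rewrite /admissible; lia.
  suff : (0 < c + u + v)%N by lia.
  by move: nt0; rewrite /t0 !xpair_eqE -!val_eqE /=; lia.
have U : (1 - fpsX ^+ (2 * l.+1) : fps int) \is a GRing.unit.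
  rewrite /in_mem /= /fps_unit coef_fpsD coef_fpsN coef_fps1.
  by rewrite coef_fps_exp_small // subr0.
(* At (0, 0) the relation [step] says that the difference is q^(2(l+1)) times itself; once it
   vanishes, [step] settles the other pairs. *)
have XY00 : coefs (X 0%N 0%N) l.+1 - coefs (Y 0%N 0%N) l.+1 = 0.
  by apply: (mulrI U); rewrite mulr0 mulrBl mul1r -(step 0%N 0%N) // subrr.
by apply/eqP; rewrite -subr_eq0 step // XY00 mulr0.
Qed.

(* With c = z q^2 and F = rs_series, the right-hand sides of the theorem. *)
Definition state (R : comNzRingType) (c : R) (F : nat -> nat -> nat -> nat -> R)
    (a b : nat) : R :=
  match a, b with
  | 0%N, 0%N => F 0%N 0%N 0%N 0%N
  | 0%N, 1%N | 1%N, 0%N => F 0%N 1%N 0%N 2%N + c * F 1%N 2%N 2%N 4%N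
  | 1%N, 1%N => F 1%N 1%N 0%N 2%N + c * F 2%N 2%N 2%N 4%N
  | _, _ => F 1%N 1%N 2%N 2%N
  end.

Section ContiguousRelations.
Variables (R : comNzRingType) (z q : R) (F : nat -> nat -> nat -> nat -> R).

(* These vanish when F is rs_series: they come from the factors (q;q)_(r1-r2),
   (q;q)_(r2), (q^2;q^2)_(s1) and (q^2;q^2)_(s2-s1) respectively. *)
Let dR1 a1 a2 b1 b2 := F a1 a2.+1 b1 b2 - F a1.+1 a2 b1 b2 -
  z * q ^+ a1.+1 * F a1.+2 a2.+1 b1.+2 b2.
Let dR2 a1 a2 b1 b2 := F a1 a2 b1 b2 - F a1 a2.+1 b1 b2 -
  z ^+ 2 * q ^+ (a1 + a2).+2 * F a1.+2 a2.+2 b1.+2 b2.+2.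
Let dS1 a1 a2 b1 b2 := F a1 a2 b1 b2 - F a1 a2 b1.+2 b2 -
  z ^+ 2 * q ^+ (b1 + b2).+4 * F a1.+2 a2.+2 b1.+4 b2.+4.
Let dS2 a1 a2 b1 b2 := F a1 a2 b1.+2 b2 - F a1 a2 b1 b2.+2 -
  z * q ^+ b2.+2 * F a1 a2.+2 b1.+2 b2.+4.

Hypothesis dR1_0 : forall a1 a2 b1 b2, dR1 a1 a2 b1 b2 = 0.
Hypothesis dR2_0 : forall a1 a2 b1 b2, dR2 a1 a2 b1 b2 = 0.
Hypothesis dS1_0 : forall a1 a2 b1 b2, dS1 a1 a2 b1 b2 = 0.
Hypothesis dS2_0 : forall a1 a2 b1 b2, dS2 a1 a2 b1 b2 = 0.

Let G20 := F 1 1 2 2.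
Let G00 := F 0 0 0 0.
Let G10 := F 0 1 0 2 + z * q ^+ 2 * F 1 2 2 4.
Let G11 := F 1 1 0 2 + z * q ^+ 2 * F 2 2 2 4.
(** The primed values are the unprimed ones after z -> z q^2: the four linear coefficients rise by 2
    and the prefactor z q^2 becomes z q^4. *)
Let G20' := F 3 3 4 4.
Let G00' := F 2 2 2 2.
Let G10' := F 2 3 2 4 + z * q ^+ 4 * F 3 4 4 6.
Let G11' := F 3 3 2 4 + z * q ^+ 4 * F 4 4 4 6.
(** [x] and [y] are the weights of a single part of size 1 and of size 2. *)
Let x := z * q.
Let y := z * q ^+ 2.

(* The combinations below were found by linear algebra over Q(z, q). *)
Lemma contiguous20 : G20 = G00' + y * G10' + y ^+ 2 * G20'.
Proof.
apply/eqP; rewrite -subr_eq0 /G20 /G00 /G10 /G11 /G20' /G00' /G10' /G11' /x /y.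
apply/eqP.
transitivity (
    dR1 1 1 2 2 - (z * q ^+ 2) * dR1 2 2 2 4 + dR2 1 1 2 2
    + dR2 2 1 2 2 + z * q ^+ 2 * dS2 3 2 2 2).
  by rewrite /dR1 /dR2 /dS1 /dS2; ring.
by rewrite !(dR1_0, dR2_0, dS1_0, dS2_0) !(mulr0, subr0, addr0).
Qed.

(** Since [state] is symmetric, triples (a', c, b') and (b', c, a') merge, which accounts for the
    coefficients 2; [G11'] comes from (1, 0, 1) alone. *)
Lemma contiguous00 : G00 =
  (1 + x + x ^+ 2) * G00' + 2%:R * y * (1 + x) * G10' + 2%:R * y ^+ 2 * G20' +
  y ^+ 2 * G11'.
Proof.
apply/eqP; rewrite -subr_eq0 /G20 /G00 /G10 /G11 /G20' /G00' /G10' /G11' /x /y.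
apply/eqP.
transitivity (
    dR1 0 0 0 0 - (z * q) * dR1 1 1 0 2
    + (1 + z * q) * dR1 1 1 2 2 + z * q ^+ 2 * dR1 1 2 2 4
    - (z * q ^+ 2 + z ^+ 2 * q ^+ 3) * dR1 2 2 2 4 + dR2 0 0 0 0
    + dR2 1 0 0 0 + dR2 1 1 0 2 + (1 + z * q) * dR2 2 1 2 2
    + z * q ^+ 2 * dR2 2 2 2 4 + dS1 1 1 0 0
    + (1 + z * q) * dS1 1 2 0 2 + dS2 1 1 0 0 + z * q * dS2 2 1 0 0
    + (z * q ^+ 2 + z ^+ 2 * q ^+ 3) * dS2 3 2 2 2).
  by rewrite /dR1 /dR2 /dS1 /dS2; ring.
by rewrite !(dR1_0, dR2_0, dS1_0, dS2_0) !(mulr0, subr0, addr0).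
Qed.

(** The coefficient 2y + xy is lopsided because, with boundary (1, 0), a part of size 1 can stand
    beside (2, colour 1) but not beside (2, colour 3). *)
Lemma contiguous10 : G10 =
  (1 + x) * G00' + (2%:R * y + x * y) * G10' + y ^+ 2 * (G11' + G20').
Proof.
apply/eqP; rewrite -subr_eq0 /G20 /G00 /G10 /G11 /G20' /G00' /G10' /G11' /x /y.
apply/eqP.
transitivity (
    dR1 0 1 0 2 + dR1 1 1 2 2 + z * q ^+ 2 * dR1 1 2 2 4
    - (z * q ^+ 2) * dR1 2 2 2 4 + dR2 0 1 0 2
    - dR2 1 0 0 2 + dR2 1 0 2 0 + dR2 1 1 0 2
    + dR2 2 1 2 2 + z * q ^+ 2 * dR2 2 2 2 4 + dS1 1 2 0 2
    - dS2 1 0 0 0 + dS2 1 1 0 0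
    + (z * q ^+ 2 + z ^+ 2 * q ^+ 3) * dS2 3 2 2 2).
  by rewrite /dR1 /dR2 /dS1 /dS2; ring.
by rewrite !(dR1_0, dR2_0, dS1_0, dS2_0) !(mulr0, subr0, addr0).
Qed.

Lemma contiguous11 : G11 = G00' + 2%:R * y * G10' + y ^+ 2 * G11'.
Proof.
apply/eqP; rewrite -subr_eq0 /G20 /G00 /G10 /G11 /G20' /G00' /G10' /G11' /x /y.
apply/eqP.
transitivity (
    dR1 1 1 2 2 - (z * q ^+ 2) * dR1 2 2 2 4 + dR2 1 1 0 2
    + dR2 2 1 2 2 + z * q ^+ 2 * dR2 2 2 2 4 + dS1 1 2 0 2
    + z * q ^+ 2 * dS2 3 2 2 2).
  by rewrite /dR1 /dR2 /dS1 /dS2; ring.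
by rewrite !(dR1_0, dR2_0, dS1_0, dS2_0) !(mulr0, subr0, addr0).
Qed.

(** Exchanging a and b preserves [state] and mirrors the admissible triples, so four identities
    cover the six pairs. *)
Lemma state_transfer a b : (a + b <= 2)%N ->
  state (z * q ^+ 2) F a b =
  \sum_(t | admissible a b t)
    z ^+ (t.1.2 + t.1.1 + t.2) * q ^+ (t.1.2 + 2 * (t.1.1 + t.2)) *
    state (z * q ^+ 4) (fun a1 a2 b1 b2 => F a1.+2 a2.+2 b1.+2 b2.+2) t.1.1 t.2.
Proof.
pose f i c j := z ^+ (c + i + j) * q ^+ (c + 2 * (i + j)) *
  state (z * q ^+ 4) (fun a1 a2 b1 b2 => F a1.+2 a2.+2 b1.+2 b2.+2) i j.
have [[f00 f10 f01] f11 f20 f02] := sum_admissible_le2 f.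
move: a b => [|[|[|a]]] [|[|[|b]]] //= _; rewrite -/(f _ _ _).
- by rewrite f00 /f /= [LHS]contiguous00 /G20' /G00' /G10' /G11' /x /y; ring.
- by rewrite f01 /f /= [LHS]contiguous10 /G20' /G00' /G10' /G11' /x /y; ring.
- by rewrite f02 /f /= [LHS]contiguous20 /G20' /G00' /G10' /G11' /x /y; ring.
- by rewrite f10 /f /= [LHS]contiguous10 /G20' /G00' /G10' /G11' /x /y; ring.
- by rewrite f11 /f /= [LHS]contiguous11 /G20' /G00' /G10' /G11' /x /y; ring.
- by rewrite f20 /f /= [LHS]contiguous20 /G20' /G00' /G10' /G11' /x /y; ring.
Qed.

End ContiguousRelations.

(** * The fermionic sums *)

Lemma unit_1subq k : (0 < k)%N -> 1 - varq ^+ k \is a GRing.unit.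
Proof.
move=> k0; rewrite /varq -fpsCX !fps_unitE !coef_fpsD !coef_fpsN !coef_fps1.
by rewrite [coefs (fpsC _) 0]/= coef_fps_exp_small // subr0.
Qed.

Definition invpoch k n : zq_series := (qpoch (varq ^+ k) (varq ^+ k) n)^-1.

(** The factor cancels the last one of the Pochhammer symbol; this is what turns a multiplied
    summand into a shifted one. *)
Lemma invpochS k n : (0 < k)%N ->
  invpoch k n.+1 * (1 - varq ^+ (k * n.+1)) = invpoch k n.
Proof.
move=> k0; rewrite /invpoch {1}/qpoch big_nat_recr //= -exprS -exprM.
have U j : 1 - varq ^+ (k * j.+1) \is a GRing.unit.
  by apply: unit_1subq; rewrite muln_gt0 k0.
have UP : qpoch (varq ^+ k) (varq ^+ k) n \is a GRing.unit.
  by apply: rpred_prod => j _; rewrite -exprS -exprM.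
by rewrite invrM // mulrC mulrA divrr // mul1r.
Qed.

Notation idx4 := ((nat * nat) * (nat * nat))%type.

(* Indexed by m = r_1 - r_2, n = r_2, u = s_1, v = s_2 - s_1; the linear part is
   a1 r_1 + a2 r_2 + b1 s_1 + b2 s_2. *)
Definition rs_exponent a1 a2 b1 b2 (x : idx4) : nat :=
  let: ((m, n), (u, v)) := x in
  ((m + n + u) ^ 2 + (n + (u + v)) ^ 2 + u ^ 2 + (u + v) ^ 2 +
   a1 * (m + n) + a2 * n + b1 * u + b2 * (u + v))%N.

Definition rs_degree (x : idx4) : nat :=
  let: ((m, n), (u, v)) := x in (m + 2 * n + 2 * u + v)%N.

Definition rs_weight (x : idx4) : zq_series :=
  let: ((m, n), (u, v)) := x in
  invpoch 1 m * invpoch 1 n * invpoch 2 u * invpoch 2 v.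

Definition rs_term a1 a2 b1 b2 (x : idx4) : zq_series :=
  varz ^+ rs_degree x * varq ^+ rs_exponent a1 a2 b1 b2 x * rs_weight x.

Definition rs_series a1 a2 b1 b2 : zq_series :=
  formal_sum setT (rs_term a1 a2 b1 b2).

(** Each of m, n, u, v has a positive coefficient in [rs_degree], so the degree in z bounds all
    four. *)
Lemma locally_finite_degree (A : set idx4) e (W : idx4 -> zq_series) :
  locally_finite A (fun x => varz ^+ rs_degree x * varq ^+ e x * W x).
Proof.
move=> l n.
pose f (x : 'I_l.+1 * 'I_l.+1 * ('I_l.+1 * 'I_l.+1)) : idx4 :=
  let: ((m, n), (u, v)) := x in ((val m, val n), (val u, val v)).
apply: (@sub_finite_set _ _ (range f)); last exact/finite_image/finite_finset.
move=> [[m k] [u v]] [_] /=; rewrite coef_monM.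
case: ifP => // /andP[dl _] _.
have [lm lk lu lv] : [/\ m < l.+1, k < l.+1, u < l.+1 & v < l.+1]%N.
  by move: dl; rewrite /rs_degree; split; lia.
by exists ((Ordinal lm, Ordinal lk), (Ordinal lu, Ordinal lv)).
Qed.

Lemma locally_finite_rs_term A a1 a2 b1 b2 :
  locally_finite A (rs_term a1 a2 b1 b2).
Proof. exact: locally_finite_degree. Qed.

(** Common pattern of the four contiguous relations. The difference on the left multiplies the
    summand by 1 - q^k, which is 0 outside the range of the index shift [h]; on that range it
    cancels a Pochhammer factor, and completing the shift leaves a monomial times a third series. *)
Lemma rs_series_sub (h : idx4 -> idx4) (k : idx4 -> nat) i j
    a1 a2 b1 b2 a1' a2' b1' b2' c1 c2 d1 d2 :
    injective h ->
    (forall x, ~ (exists y, h y = x) -> k x = 0%N) ->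
    (forall x,
      rs_exponent a1' a2' b1' b2' x = (rs_exponent a1 a2 b1 b2 x + k x)%N) ->
    (forall x, rs_degree (h x) = (rs_degree x + i)%N) ->
    (forall x,
      rs_exponent a1 a2 b1 b2 (h x) = (j + rs_exponent c1 c2 d1 d2 x)%N) ->
    (forall x, rs_weight (h x) * (1 - varq ^+ k (h x)) = rs_weight x) ->
  rs_series a1 a2 b1 b2 - rs_series a1' a2' b1' b2' =
  varz ^+ i * varq ^+ j * rs_series c1 c2 d1 d2.
Proof.
move=> hI k0 eq_k deg expo wt.
rewrite /rs_series -formal_sumN -formal_sumD; last first.
- move=> l n.
  apply: sub_finite_set (locally_finite_rs_term setT a1' a2' b1' b2' l n).
  by move=> x [_ nz]; split => // z; apply: nz; rewrite !coef_fpsN z oppr0.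
- exact: locally_finite_rs_term.
rewrite (formal_sum_inj hI) => [|x nx].
  rewrite -formal_sum_mon; apply: eq_formal_sum => x _ /=.
  rewrite /rs_term eq_k deg expo -(wt x) !exprD; ring.
by rewrite /rs_term eq_k k0 // addn0 subrr.
Qed.

(** The two linear parts differ by r_1 - r_2 = m. Raising m raises r_1 alone, and (r_1 + s_1)^2
    grows by 2 r_1 + 2 s_1 + 1. *)
Lemma rs_series_R1 a1 a2 b1 b2 :
  rs_series a1 a2.+1 b1 b2 - rs_series a1.+1 a2 b1 b2 -
  varz * varq ^+ a1.+1 * rs_series a1.+2 a2.+1 b1.+2 b2 = 0.
Proof.
apply/eqP; rewrite subr_eq0; apply/eqP.
apply: (@rs_series_sub (fun '((m, n), (u, v)) => ((m.+1, n), (u, v)))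
  (fun x => x.1.1) 1).
- by move=> [[m n] [u v]] [[m' n'] [u' v']] [-> -> -> ->].
- by move=> [[[|m] n] [u v]] //= []; exists ((m, n), (u, v)).
- by move=> [[m n] [u v]]; rewrite /rs_exponent /=; lia.
- by move=> [[m n] [u v]]; rewrite /rs_degree /=; lia.
- by move=> [[m n] [u v]]; rewrite /rs_exponent /= -!mulnn; lia.
- move=> [[m n] [u v]]; rewrite /rs_weight -(@invpochS 1 m isT) mul1n.
  move: (invpoch 1 m.+1) (invpoch 1 n) (invpoch 2 u) (invpoch 2 v) (varq ^+ _).
  by move=> *; ring.
Qed.

(** Here k = r_2 = n, and raising n at fixed m raises both r_1 and r_2, whence the factor z^2. *)
Lemma rs_series_R2 a1 a2 b1 b2 :
  rs_series a1 a2 b1 b2 - rs_series a1 a2.+1 b1 b2 -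
  varz ^+ 2 * varq ^+ (a1 + a2).+2 * rs_series a1.+2 a2.+2 b1.+2 b2.+2 = 0.
Proof.
apply/eqP; rewrite subr_eq0; apply/eqP.
apply: (@rs_series_sub (fun '((m, n), (u, v)) => ((m, n.+1), (u, v)))
  (fun x => x.1.2) 2).
- by move=> [[m n] [u v]] [[m' n'] [u' v']] [-> -> -> ->].
- by move=> [[m [|n]] [u v]] //= []; exists ((m, n), (u, v)).
- by move=> [[m n] [u v]]; rewrite /rs_exponent /=; lia.
- by move=> [[m n] [u v]]; rewrite /rs_degree /=; lia.
- by move=> [[m n] [u v]]; rewrite /rs_exponent /= -!mulnn; lia.
- move=> [[m n] [u v]]; rewrite /rs_weight -(@invpochS 1 n isT) mul1n.
  move: (invpoch 1 m) (invpoch 1 n.+1) (invpoch 2 u) (invpoch 2 v) (varq ^+ _).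
  by move=> *; ring.
Qed.

(** Here k = 2 s_1 = 2u. Raising u at fixed v raises both s_1 and s_2, each of which occurs in two
    squares, whence the increments by 4. *)
Lemma rs_series_S1 a1 a2 b1 b2 :
  rs_series a1 a2 b1 b2 - rs_series a1 a2 b1.+2 b2 -
  varz ^+ 2 * varq ^+ (b1 + b2).+4 * rs_series a1.+2 a2.+2 b1.+4 b2.+4 = 0.
Proof.
apply/eqP; rewrite subr_eq0; apply/eqP.
apply: (@rs_series_sub (fun '((m, n), (u, v)) => ((m, n), (u.+1, v)))
  (fun x => 2 * x.2.1)%N 2).
- by move=> [[m n] [u v]] [[m' n'] [u' v']] [-> -> -> ->].
- by move=> [[m n] [[|u] v]] //= []; exists ((m, n), (u, v)).
- by move=> [[m n] [u v]]; rewrite /rs_exponent /=; lia.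
- by move=> [[m n] [u v]]; rewrite /rs_degree /=; lia.
- by move=> [[m n] [u v]]; rewrite /rs_exponent /= -!mulnn; lia.
- move=> [[m n] [u v]]; rewrite /rs_weight -(@invpochS 2 u isT).
  move: (invpoch 1 m) (invpoch 1 n) (invpoch 2 u.+1) (invpoch 2 v) (varq ^+ _).
  by move=> *; ring.
Qed.

(** The two linear parts differ by 2 (s_2 - s_1) = 2v, and raising v raises s_2 alone. *)
Lemma rs_series_S2 a1 a2 b1 b2 :
  rs_series a1 a2 b1.+2 b2 - rs_series a1 a2 b1 b2.+2 -
  varz * varq ^+ b2.+2 * rs_series a1 a2.+2 b1.+2 b2.+4 = 0.
Proof.
apply/eqP; rewrite subr_eq0; apply/eqP.
apply: (@rs_series_sub (fun '((m, n), (u, v)) => ((m, n), (u, v.+1)))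
  (fun x => 2 * x.2.2)%N 1).
- by move=> [[m n] [u v]] [[m' n'] [u' v']] [-> -> -> ->].
- by move=> [[m n] [u [|v]]] //= []; exists ((m, n), (u, v)).
- by move=> [[m n] [u v]]; rewrite /rs_exponent /=; lia.
- by move=> [[m n] [u v]]; rewrite /rs_degree /=; lia.
- by move=> [[m n] [u v]]; rewrite /rs_exponent /= -!mulnn; lia.
- move=> [[m n] [u v]]; rewrite /rs_weight -(@invpochS 2 v isT).
  move: (invpoch 1 m) (invpoch 1 n) (invpoch 2 u) (invpoch 2 v.+1) (varq ^+ _).
  by move=> *; ring.
Qed.

Lemma invpoch0 k : invpoch k 0 = 1.
Proof. by rewrite /invpoch /qpoch (big_geq (leqnn 0)) invr1. Qed.

(** Being constant in z, these factors are fixed by [zshift]. *)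
Lemma invpochE k n : (0 < k)%N ->
  invpoch k n = fpsC (qpoch (fpsX ^+ k) (fpsX ^+ k) n)^-1.
Proof.
move=> k0; rewrite fpsCV.
  rewrite /invpoch /qpoch (big_morph _ (@fpsCM _) (erefl (1 : zq_series))).
  congr (_^-1); apply: eq_bigr => j _.
  by rewrite fpsCB fpsCM !fpsCX.
apply: rpred_prod => j _; rewrite -exprS -exprM fps_unitE coef_fpsD coef_fpsN.
by rewrite coef_fps1 coef_fps_exp_small ?subr0 // muln_gt0 k0.
Qed.

Lemma coef0_rs_series a1 a2 b1 b2 : coefs (rs_series a1 a2 b1 b2) 0 = 1.
Proof.
rewrite (@coef0_formal_sum _ _ _ ((0, 0), (0, 0))%N) //.
  rewrite /rs_term /rs_weight !invpoch0 !mulr1.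
  apply: fpsP => n; rewrite coef_mon coef_fps1 /=.
  by rewrite /rs_exponent !muln0.
move=> [[m k] [u v]] _ nz; apply: fpsP => n; rewrite coef_monM ifF //.
apply/negP => /andP[dl _]; apply: nz; move: dl; rewrite /rs_degree => dl.
by congr (_, _, (_, _)); lia.
Qed.

(** The substitution contributes q^(2 (r_1 + r_2 + s_1 + s_2)), which is again linear in r and s. *)
Lemma zshift_rs_series a1 a2 b1 b2 :
  zshift (rs_series a1 a2 b1 b2) = rs_series a1.+2 a2.+2 b1.+2 b2.+2.
Proof.
rewrite /rs_series -formal_sum_zshift; apply: eq_formal_sum => x _.
rewrite /rs_term zshiftM_mon; congr (varz ^+ _ * varq ^+ _ * _).
  by move: x => [[m n] [u v]]; rewrite /rs_exponent /rs_degree; lia.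
by move: x => [[m n] [u v]]; rewrite /rs_weight !invpochE // -!fpsCM zshiftC.
Qed.

Definition rs_state := state (varz * varq ^+ 2) rs_series.

Lemma zshift_rs_state a b : zshift (rs_state a b) =
  state (varz * varq ^+ 4)
    (fun a1 a2 b1 b2 => rs_series a1.+2 a2.+2 b1.+2 b2.+2) a b.
Proof.
have zM f : zshift (varz * varq ^+ 2 * f) = varz * varq ^+ 4 * zshift f.
  exact: (zshiftM_mon 1 2).
rewrite /rs_state.
move: a b => [|[|a]] [|[|b]];
by rewrite [in LHS]/state ?zshiftD ?zM !zshift_rs_series.
Qed.

Lemma rs_state_transfer a b : (a + b <= 2)%N ->
  rs_state a b = transfer rs_state a b.
Proof.
move=> ab; rewrite {1}/rs_state state_transfer //.
- by apply: eq_bigr => -[[i c] j] _; rewrite /transfer_term zshift_rs_state.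
- exact: rs_series_R1.
- exact: rs_series_R2.
- exact: rs_series_S1.
- exact: rs_series_S2.
Qed.

Lemma coef0_rs_state a b : coefs (rs_state a b) 0 = 1.
Proof.
have c0 f : coefs (varz * varq ^+ 2 * f) 0 = 0.
  by rewrite -[varz]expr1; apply: fpsP => n; rewrite coef_monM.
rewrite /rs_state; move: a b => [|[|a]] [|[|b]];
by rewrite [state _ _ _ _]/state ?coef_fpsD ?c0 ?addr0 coef0_rs_series.
Qed.

(** The four products of the theorem differ only in the exponent of q, which is abstracted as
    [e i r_i s_i]. *)
Definition rs_prod (e : nat -> nat -> nat -> nat) (r s : nat -> nat) :
    zq_series :=
  \prod_(1 <= i < 3)
    (varz ^+ (r i + s i) * varq ^+ e i (r i) (s i) *
     inv_qpoch varq ((r i)%:Z - (r i.+1)%:Z) *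
     inv_qpoch (varq ^+ 2) ((s i)%:Z - (s i.-1)%:Z)).

Lemma inv_qpoch_sub k (m n : nat) :
  inv_qpoch (varq ^+ k) ((m + n)%N%:Z - n%:Z) = invpoch k m.
Proof. by rewrite PoszD addrK. Qed.

Lemma inv_qpoch_lt (x : zq_series) (m n : nat) : (m < n)%N ->
  inv_qpoch x (m%:Z - n%:Z) = 0.
Proof. by move=> mn; case E : (m%:Z - n%:Z) => [k|k] //; lia. Qed.

Lemma rs_prodE e m n u v :
  rs_prod e (ext2 (m + n, n)%N) (ext2 (u, v + u)%N) =
  varz ^+ rs_degree ((m, n), (u, v)) *
  varq ^+ (e 1 (m + n) u + e 2 n (v + u))%N * rs_weight ((m, n), (u, v)).
Proof.
(* The boundary values r_3 = s_0 = 0 and the base q are spelled out as [+ 0], [- 0] and [varq ^+ 1],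
   so that one rule rewrites all four Pochhammer factors. *)
transitivity (varz ^+ (m + n + u) * varq ^+ e 1%N (m + n)%N u *
    inv_qpoch (varq ^+ 1) ((m + n)%N%:Z - n%:Z) *
    inv_qpoch (varq ^+ 2) ((u + 0)%N%:Z - 0%:Z) *
    (varz ^+ (n + (v + u)) * varq ^+ e 2%N n (v + u)%N *
    inv_qpoch (varq ^+ 1) ((n + 0)%N%:Z - 0%:Z) *
    inv_qpoch (varq ^+ 2) ((v + u)%N%:Z - u%:Z))).
  by rewrite /rs_prod big_ltn // big_nat1 !addn0 expr1.
rewrite !inv_qpoch_sub /rs_weight /rs_degree.
have -> : (m + 2 * n + 2 * u + v = m + n + u + (n + (v + u)))%N by lia.
rewrite !exprD.
move: (invpoch 1 m) (invpoch 1 n) (invpoch 2 u) (invpoch 2 v).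
move: (varq ^+ _) (varq ^+ _) (varz ^+ m) (varz ^+ n) (varz ^+ u) (varz ^+ v).
by move=> *; ring.
Qed.

Lemma rs_prod_eq0 e r s : (r.1 < r.2)%N || (s.2 < s.1)%N ->
  rs_prod e (ext2 r) (ext2 s) = 0.
Proof.
(* [c] is the base q factor for i = 1, zero when r_1 < r_2; [d'] is the base q^2 factor for i = 2,
   zero when s_2 < s_1. *)
have mul0 (a b c d a' b' c' d' : zq_series) : c = 0 \/ d' = 0 ->
    a * b * c * d * (a' * b' * c' * d') = 0.
  by case=> ->; rewrite ?(mulr0, mul0r).
rewrite /rs_prod big_ltn // big_nat1 => rs; apply: mul0.
by case/orP: rs => rs; [left|right]; exact: inv_qpoch_lt.
Qed.

Lemma sum_rs_reindex (P : (nat -> nat) -> (nat -> nat) -> zq_series)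
    (G : idx4 -> zq_series) :
    (forall m n u v, P (ext2 (m + n, n)%N) (ext2 (u, v + u)%N) =
                     G ((m, n), (u, v))) ->
    (forall r s, (r.1 < r.2)%N || (s.2 < s.1)%N -> P (ext2 r) (ext2 s) = 0) ->
  sum_rs P = formal_sum setT G.
Proof.
move=> PG P0; pose h (x : idx4) : idx4 :=
  ((x.1.1 + x.1.2, x.1.2), (x.2.1, x.2.2 + x.2.1))%N.
rewrite /sum_rs [LHS](@formal_sum_inj _ _ h).
- by apply: eq_formal_sum => -[[m n] [u v]] _; exact: PG.
- move=> [[m n] [u v]] [[m' n'] [u' v']] [mm nn uu vv].
  by congr (_, _, (_, _)); lia.
- move=> [[r1 r2] [s1 s2]] nh; apply: P0 => /=.
  case: ltnP => //= r12; case: ltnP => //= s12; case: nh.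
  by exists ((r1 - r2, r2), (s1, s2 - s1))%N; rewrite /h /= !subnK.
Qed.

Lemma sum_rs_prod e a1 a2 b1 b2 :
    (forall m n u v, (e 1 (m + n) u + e 2 n (v + u))%N =
                     rs_exponent a1 a2 b1 b2 ((m, n), (u, v))) ->
  sum_rs (rs_prod e) = rs_series a1 a2 b1 b2.
Proof.
move=> eE; apply: sum_rs_reindex => [m n u v|r s]; last exact: rs_prod_eq0.
by rewrite rs_prodE eE.
Qed.

(** The sum in the prefactor is itself linear, so it raises the coefficients of r_1, r_2, s_1, s_2
    by 1, 1, 2, 2 and yields a second series of the same family. *)
Lemma sum_rs_prod2 e a1 a2 b1 b2 :
    (forall m n u v, (e 1 (m + n) u + e 2 n (v + u))%N =
                     rs_exponent a1 a2 b1 b2 ((m, n), (u, v))) ->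
  sum_rs (fun r s =>
    (1 + varz * varq ^+ (2 + \sum_(1 <= i < 3) (r i + 2 * s i))) *
    rs_prod e r s) =
  rs_series a1 a2 b1 b2 +
  varz * varq ^+ 2 * rs_series a1.+1 a2.+1 b1.+2 b2.+2.
Proof.
move=> eE; rewrite -[varz in RHS]expr1 /rs_series -formal_sum_mon -formal_sumD.
- apply: sum_rs_reindex => [m n u v|r s rs]; last first.
    by rewrite rs_prod_eq0 // mulr0.
  have aux (z q W : zq_series) d c k :
      (1 + z * q ^+ (2 + k)) * (z ^+ d * q ^+ c * W) =
      z ^+ d * q ^+ c * W + z ^+ 1 * q ^+ 2 * (z ^+ d * q ^+ (k + c) * W).
    by rewrite !exprD expr1; ring.
  rewrite rs_prodE eE aux /rs_term; congr (_ + _ * (_ * varq ^+ _ * _)).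
  by rewrite big_ltn // big_nat1 /rs_exponent /ext2 /=; lia.
- exact: locally_finite_rs_term.
- by apply: locally_finite_mon; exact: locally_finite_rs_term.
Qed.

(** * The coloured partitions *)

Section Partitions.
Local Open Scope nat_scope.
Implicit Types la mu : partition3.

(* The junk value la (0, c) is replaced by the boundary multiplicity a. *)
Definition even_freq (a : nat) la (c k : nat) : nat :=
  if k == 0 then a else la (2 * k, c).

(** A path with middle size 2i + 1 has its ends at 2i or 2i + 2; [e] and [e'] make the two
    choices. *)
Definition path_bound (a b : nat) la : Prop := forall (i : nat) (e e' : bool),
  even_freq a la 1 (i + e) + la ((2 * i).+1, 2) + even_freq b la 3 (i + e') <= 2.

Lemma DsetP k0 k1 k2 la : k0 + k1 + k2 = 2 ->
  Dset k0 k1 k2 la <-> is_partition3 la /\ path_bound k0 k2 la.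
Proof.
move=> k012; split=> -[pla bla]; split=> //.
  move=> i e e'.
  have /bla : is_path (2 * (i + e))%N%:Z (2 * i).+1%:Z (2 * (i + e'))%N%:Z.
    by rewrite /is_path; split; try lia; case: e; case: e'; lia.
  rewrite k012 /freq /even_freq /= !eqz_nat.
  by rewrite !muln_eq0.
move=> i1 i2 i3 [[i1_ge0 i1e] [i2_ge i2o] [i3_ge0 i3e] d12 d23].
(* The only path through -1 has both ends at 0, and its bound is the equality k_0 + k_1 + k_2 =
   2. *)
rewrite k012; have [i2N|i2_neqN] := eqVneq i2 (-1)%R.
  have -> : i1 = 0%R by lia.
  have -> : i3 = 0%R by lia.
  by rewrite i2N /freq /= k012.
have [i i2E] : exists i, i2 = (2 * i).+1%:Z by exists `|i2|%N./2; lia.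
have [e i1E] : exists e : bool, i1 = (2 * (i + e))%N%:Z.
  have : i1 = (i2 - 1)%R \/ i1 = (i2 + 1)%R by lia.
  by case=> ?; [exists false|exists true]; lia.
have [e' i3E] : exists e : bool, i3 = (2 * (i + e))%N%:Z.
  have : i3 = (i2 - 1)%R \/ i3 = (i2 + 1)%R by lia.
  by case=> ?; [exists false|exists true]; lia.
have := bla i e e'; rewrite i1E i2E i3E /freq /even_freq /= !eqz_nat.
by rewrite !muln_eq0.
Qed.

Definition shift_part (p : part) : part := (p.1.+2, p.2).

(* Puts back a, c, b copies of (2, 1), (1, 2), (2, 3) under the raised la. *)
Definition glue (a c b : nat) la : partition3 :=
  seq_mset (nseq c (1, 2) ++ nseq a (2, 1) ++ nseq b (2, 3) ++
            map shift_part la).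

Lemma glueE a c b la (p : part) :
  glue a c b la p = c * (p == (1, 2)) + a * (p == (2, 1)) + b * (p == (2, 3)) +
    (if 1 < p.1 then la (p.1 - 2, p.2) else 0).
Proof.
rewrite mset_seqE !count_cat !count_nseq count_map.
rewrite ![(pred1 p) (_, _)]/= ![(_, _) == p]eq_sym !addnA.
congr (_ + _); try by rewrite !(mulnC (_ == _)).
case: p => [[|[|m]] k] /=.
- by apply/eqP; rewrite -leqn0 leqNgt -has_count; apply/hasPn => -[].
- by apply/eqP; rewrite -leqn0 leqNgt -has_count; apply/hasPn => -[].
- rewrite subn2 /= -count_mem_mset; apply: eq_count => -[x y] /=.
  by rewrite /shift_part !xpair_eqE /=.
Qed.

Lemma length_glue a c b la : length (glue a c b la) = c + a + b + length la.
Proof.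
rewrite /length (perm_size (perm_eq_seq_mset _)) !size_cat !size_nseq size_map.
by rewrite !addnA.
Qed.

Lemma weight_glue a c b la :
  weight (glue a c b la) = c + 2 * (a + b) + (weight la + 2 * length la).
Proof.
rewrite /weight (perm_big _ (perm_eq_seq_mset _)) /= !big_cat /= !big_nseq.
rewrite !iter_addn_0 big_map /shift_part /=.
rewrite (eq_bigr (fun p : part => p.1 + 2)); last by move=> p _; rewrite addn2.
rewrite big_split /= big_const_seq count_predT iter_addn_0 /length.
by rewrite mul1n mulnDr !addnA.
Qed.

Lemma partition3_odd_size la m k : is_partition3 la -> k <> 2 ->
  (m == 0) || odd m -> la (m, k) = 0.
Proof.
move=> pla k2 m_odd; apply/mset_eq0P; apply/negP => /pla [/= m1].
by case=> [[]|[_]] //; lia.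
Qed.

Lemma partition3_even_size la m : is_partition3 la -> ~~ odd m -> la (m, 2) = 0.
Proof.
move=> pla m_ev; apply/mset_eq0P; apply/negP => /pla [/= m1].
by case=> [[_]|[[]]] //; lia.
Qed.

Lemma is_partition3_glue a c b la :
  is_partition3 la -> is_partition3 (glue a c b la).
Proof.
move=> pla p; rewrite (perm_mem (perm_eq_seq_mset _)) !mem_cat !mem_nseq.
case/or4P => [/andP[_ /eqP->]|/andP[_ /eqP->]|/andP[_ /eqP->]|].
- by split=> //; left.
- by split=> //; right; split=> //; left.
- by split=> //; right; split=> //; right.
by case/mapP=> -[m k] /pla[m1 mk] ->; split=> //=; rewrite negbK.
Qed.

(** The four paths with middle size 1 see a or a', and b or b', at their ends, so together they
    bound the sum of the maxima. The paths further up are those of [la], for which a' and b' act as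
    boundary values. *)
Lemma path_bound_glue a b a' c b' la : is_partition3 la ->
  path_bound a b (glue a' c b' la) <->
  maxn a a' + c + maxn b b' <= 2 /\ path_bound a' b' la.
Proof.
move=> pla.
have even_glueS a0 x k i : k <> 2 -> x = (if k == 1 then a' else b') ->
    (k == 1) || (k == 3) ->
    even_freq a0 (glue a' c b' la) k i.+1 = even_freq x la k i.
  move=> k2 -> k13; rewrite /even_freq glueE /= mulnS.
  rewrite !xpair_eqE.
  case: i => [|i] /=.
    rewrite (partition3_odd_size pla) // ?muln0 //.
    by case/orP: k13 => /eqP ->; rewrite /= ?muln0 ?muln1 ?addn0 ?add0n.
  rewrite addKn; case: (2 + 2 * i.+1 == 1) / eqP => [|_]; first by lia.
  case: (2 + 2 * i.+1 == 2) / eqP => [|_]; first by lia.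
  by rewrite !muln0 !add0n.
have odd_glue i : glue a' c b' la ((2 * i).+1, 2) =
    if i is i'.+1 then la ((2 * i').+1, 2) else c.
  rewrite glueE !xpair_eqE /=; case: i => [|i] /=.
    by rewrite !muln0 muln1 !addn0.
  rewrite andbF !muln0 mulnS /= !subSS subn0.
  by case: (2 * i) => [|[|j]]; rewrite ?muln0.
split=> [bla|[b0 bla]].
  split=> [|i e e'].
    (* These Booleans select the path on which both maxima are attained. *)
    have /= := bla 0 (a < a') (b < b').
    rewrite odd_glue /maxn; case: (a < a'); case: (b < b');
      rewrite /= ?(@even_glueS _ a' 1) ?(@even_glueS _ b' 3) //.
  have := bla i.+1 e e'; rewrite odd_glue !addSn.
  by rewrite (@even_glueS _ a' 1) // (@even_glueS _ b' 3).
move=> [|i] e e'; last first.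
  by rewrite odd_glue !addSn (@even_glueS _ a' 1) // (@even_glueS _ b' 3).
apply: leq_trans b0; rewrite odd_glue !add0n.
apply: leq_add; first apply: leq_add => //.
  case: e; rewrite ?leq_maxl // (@even_glueS _ a' 1) //.
  by rewrite /even_freq /= leq_maxr.
case: e'; rewrite ?leq_maxl // (@even_glueS _ b' 3) //.
by rewrite /even_freq /= leq_maxr.
Qed.

(** [inord] sends values above 2 to 0, but the path bound at level 2 keeps all three multiplicities
    at most 2. *)
Definition first_freqs la : 'I_3 * 'I_3 * 'I_3 :=
  (inord (la (2, 1)), inord (la (1, 2)), inord (la (2, 3))).

Definition upper la : partition3 :=
  seq_mset [seq (p.1 - 2, p.2) | p <- la & 2 < p.1].

Lemma upperE la m k : upper la (m, k) = if 0 < m then la (m.+2, k) else 0.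
Proof.
rewrite mset_seqE count_map count_filter -count_mem_mset; case: ltnP => m0.
  apply: eq_count => -[x y] /=; rewrite !xpair_eqE /=.
  by case: eqVneq; case: (y == k); rewrite ?andbT ?andbF //; lia.
apply/eqP; rewrite -leqn0 leqNgt -has_count; apply/hasPn => -[x y] _ /=.
by rewrite xpair_eqE /=; lia.
Qed.

Lemma is_partition3_upper la : is_partition3 la -> is_partition3 (upper la).
Proof.
move=> pla [m k]; rewrite in_mset upperE; case: ifP => // m0.
by rewrite mset_gt0 => /pla [_ /=]; rewrite negbK; split.
Qed.

(** The parity conditions leave only colour 2 for size 1 and colours 1 and 3 for size 2, so the
    three multiplicities record every part that [upper] discards. *)
Lemma glue_upper la : is_partition3 la ->
  glue (la (2, 1)) (la (1, 2)) (la (2, 3)) (upper la) = la.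
Proof.
move=> pla; apply/msetP => -[m k]; rewrite glueE upperE !xpair_eqE /=.
case: m => [|[|[|m]]] /=; rewrite ?muln0 ?add0n //.
- have [->|/eqP k2] := eqVneq k 2; first by rewrite (partition3_even_size pla).
  by rewrite (@partition3_odd_size _ 0 k).
- have [->|/eqP k2] := eqVneq k 2; first by rewrite muln1 !addn0.
  by rewrite (@partition3_odd_size _ 1 k) // muln0.
- have [->|/eqP k1] := eqVneq k 1; first by rewrite /= muln1 muln0 !addn0.
  have [->|/eqP k3] := eqVneq k 3; first by rewrite /= muln1 muln0 !addn0.
  rewrite !muln0; have [->|/eqP k2] := eqVneq k 2.
    by rewrite (partition3_even_size pla).
  by apply/esym/mset_eq0P/negP => /pla [_ /= [[]|[[]]]].
Qed.

End Partitions.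

(** A partition of length l and weight n is an l-tuple of pairs with sizes at most n and colours at
    most 3, up to order. *)
Lemma locally_finite_partitions (A : set partition3) :
  (forall la, A la -> is_partition3 la) ->
  locally_finite A (fun la => varz ^+ length la * varq ^+ weight la).
Proof.
move=> pA l n.
pose f (t : l.-tuple ('I_n.+1 * 'I_4)) : partition3 :=
  seq_mset [seq ((val p.1, val p.2) : part) | p <- t].
apply: (@sub_finite_set _ _ (range f)); last exact/finite_image/finite_finset.
move=> la [Ala]; rewrite /= coef_mon; case: andP => // -[/eqP ll /eqP wn] _.
have small p : p \in la -> (p.1 < n.+1)%N /\ (p.2 < 4)%N.
  move=> pla; split.
    rewrite ltnS wn /weight (perm_big _ (perm_to_rem pla)) /=.
    by rewrite big_cons leq_addr.
  by have [_ [[->]|[[->|->]]]] := pA _ Ala _ pla.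
pose s : seq ('I_n.+1 * 'I_4) := [seq (inord p.1, inord p.2) | p <- la].
have sl : size s == l by rewrite size_map ll.
exists (Tuple sl) => //; rewrite /f /= -map_comp -[RHS]seq_mset_id.
congr seq_mset; rewrite -[RHS]map_id.
apply/eq_in_map => -[m k] /small [/= mn k4].
by rewrite !inordK.
Qed.

(** At the fixed level 2 the middle index k_1 is determined by k_0 and k_2. *)
Definition dstate (a b : nat) : zq_series := Dseries a (2 - (a + b)) b.

Lemma coef0_dstate a b : (a + b <= 2)%N -> coefs (dstate a b) 0 = 1.
Proof.
move=> ab; rewrite /dstate /Dseries (@coef0_formal_sum _ _ _ mset0).
- apply: fpsP => n; rewrite coef_mon coef_fps1 /length /weight big_mset0.
  by rewrite enum_mset0.
- apply/DsetP; first by lia.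
  split=> [p|i e e']; first by rewrite in_mset0.
  rewrite /even_freq !mset0E.
  by case: (_ == _); case: (_ == _); lia.
move=> la _ nz; apply: fpsP => n; rewrite coef_mon.
case: andP => // -[/eqP/esym/size0nil la0 _]; case: nz.
by apply/msetP => p; rewrite -count_mem_mset la0 mset0E.
Qed.

(** The partitions are sorted by [first_freqs]: on an admissible fibre [glue] is a bijection from
    the smaller problem, and the other fibres are empty. *)
Lemma dstate_transfer a b : (a + b <= 2)%N ->
  dstate a b = transfer dstate a b.
Proof.
move=> ab; rewrite {1}/dstate /Dseries.
have DP x y la : (x + y <= 2)%N -> Dset x (2 - (x + y)) y la <->
    is_partition3 la /\ path_bound x y la by move=> xy; apply: DsetP; lia.
rewrite (@formal_sum_fibers _ _ _ first_freqs); last first.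
  by apply: locally_finite_partitions => la [].
rewrite /transfer [RHS]big_mkcond; apply: eq_bigr => -[[i c] j] _.
have inv la : Dset a (2 - (a + b)) b la -> first_freqs la = (i, c, j) ->
  [/\ la (2, 1) = i, la (1, 2) = c & la (2, 3) = j]%N.
  move=> /(DP _ _ _ ab)[_ bla] [<- <- <-].
  (* The path with sizes 2, 1, 2 bounds the three multiplicities, so [inord] loses nothing. *)
  have le2 : (la (2, 1) + la (1, 2) + la (2, 3) <= 2)%N := bla 0%N true true.
  have small x y z : (x + y + z <= 2)%N -> [/\ x < 3, y < 3 & z < 3]%N.
    by split; lia.
  by have [? ? ?] := small _ _ _ le2; rewrite !inordK.
case: ifP => [adm|nadm].
  rewrite /transfer_term /dstate /Dseries -formal_sum_zshift -formal_sum_mon.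
  have ij : (i + j <= 2)%N by move: adm; rewrite /admissible; lia.
  rewrite (@formal_sum_image _ _ (Dset i (2 - (i + j)) j) _ (glue i c j)).
    apply: eq_formal_sum => la _ /=; rewrite length_glue weight_glue.
    by rewrite zshift_mon !exprD mulrACA.
  split.
  - move=> la /(DP _ _ _ ij)[pla bla]; split.
      apply/DP => //; split; first exact: is_partition3_glue.
      by apply/path_bound_glue.
    rewrite /= /first_freqs !glueE /= subnn.
    rewrite !(@partition3_odd_size _ 0 _ pla) //.
    by rewrite !muln0 !muln1 ?addn0 ?add0n !inord_val.
  - move=> la mu /set_mem/(DP _ _ _ ij)[pla _].
    move=> /set_mem/(DP _ _ _ ij)[pmu _] eq_g.
    (* Size m + 1 is read off at size m + 3 of the glued partition, above everything that was put
       back; size 0 does not occur in a partition. *)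
    apply/msetP => -[[|m] k].
      have z nu : is_partition3 nu -> nu (0%N, k) = 0%N.
        by move=> pnu; apply/mset_eq0P/negP => /pnu [].
      by rewrite !z.
    have := congr1 (fun nu : partition3 => nu (m.+3, k)) eq_g.
    by rewrite !glueE !xpair_eqE /= !muln0 !add0n.
  - move=> la [Dla fla]; have [fi fc fj] := inv _ Dla fla.
    move: Dla => /(DP _ _ _ ab)[pla bla].
    exists (upper la); last by rewrite -fi -fc -fj glue_upper.
    apply/DP => //; split; first exact: is_partition3_upper.
    move: bla; rewrite -{1}(glue_upper pla) fi fc fj.
    by case/(path_bound_glue _ _ _ _ _ (is_partition3_upper pla)).
rewrite -(@formal_sum_widen _ set0); last first.
- move=> la [Dla fla] _; have [fi fc fj] := inv _ Dla fla.
  move: Dla => /(DP _ _ _ ab)[pla]; rewrite -{1}(glue_upper pla) fi fc fj.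
  case/(path_bound_glue _ _ _ _ _ (is_partition3_upper pla)) => adm _.
  by rewrite /admissible adm in nadm.
- by [].
by apply: fpsP => l; apply: fpsP => n; rewrite formal_sumE fsbig_set0.
Qed.

Theorem theorem4p10 :
  [/\ Dseries 2 0 0 =
        sum_rs (fun r s => \prod_(1 <= i < 3)
          (varz ^+ (r i + s i)
           * varq ^+ ((r i + s i) ^ 2 + s i ^ 2 + r i + 2 * s i)
           * inv_qpoch varq ((r i)%:Z - (r i.+1)%:Z)
           * inv_qpoch (varq ^+ 2) ((s i)%:Z - (s i.-1)%:Z))),
      Dseries 0 2 0 =
        sum_rs (fun r s => \prod_(1 <= i < 3)
          (varz ^+ (r i + s i)
           * varq ^+ ((r i + s i) ^ 2 + s i ^ 2)
           * inv_qpoch varq ((r i)%:Z - (r i.+1)%:Z)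
           * inv_qpoch (varq ^+ 2) ((s i)%:Z - (s i.-1)%:Z))),
      Dseries 1 1 0 =
        sum_rs (fun r s =>
          (1 + varz * varq ^+ (2 + \sum_(1 <= i < 3) (r i + 2 * s i))) *
          \prod_(1 <= i < 3)
          (varz ^+ (r i + s i)
           * varq ^+ ((r i + s i) ^ 2 + s i ^ 2 + (i == 2%N) * (r i + 2 * s i))
           * inv_qpoch varq ((r i)%:Z - (r i.+1)%:Z)
           * inv_qpoch (varq ^+ 2) ((s i)%:Z - (s i.-1)%:Z)))
    & Dseries 1 0 1 =
        sum_rs (fun r s =>
          (1 + varz * varq ^+ (2 + \sum_(1 <= i < 3) (r i + 2 * s i))) *
          \prod_(1 <= i < 3)
          (varz ^+ (r i + s i)
           * varq ^+ ((r i + s i) ^ 2 + s i ^ 2 + r i + 2 * (i == 2%N) * s i)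
           * inv_qpoch varq ((r i)%:Z - (r i.+1)%:Z)
           * inv_qpoch (varq ^+ 2) ((s i)%:Z - (s i.-1)%:Z)))].
Proof.
have key a b : (a + b <= 2)%N -> dstate a b = rs_state a b.
  apply: transfer_unique; [exact: dstate_transfer|exact: rs_state_transfer|].
  by move=> a' b' ab'; rewrite coef0_dstate // coef0_rs_state.
split.
(* In the four cases [key] is used at (k_0, k_2), and the numerals that close each instance are the
   coefficients of r_1, r_2, s_1, s_2 in the exponent of q. *)
- apply: etrans (key 2%N 0%N isT) _; apply/esym.
  apply: (@sum_rs_prod (fun i r s => (r + s) ^ 2 + s ^ 2 + r + 2 * s)%N 1 1 2 2).
  by move=> m n u v; rewrite /rs_exponent; lia.
- apply: etrans (key 0%N 0%N isT) _; apply/esym.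
  apply: (@sum_rs_prod (fun i r s => (r + s) ^ 2 + s ^ 2)%N 0 0 0 0).
  by move=> m n u v; rewrite /rs_exponent; lia.
- apply: etrans (key 1%N 0%N isT) _; apply/esym.
  apply: (@sum_rs_prod2
    (fun i r s => (r + s) ^ 2 + s ^ 2 + (i == 2) * (r + 2 * s))%N 0 1 0 2).
  by move=> m n u v; rewrite /rs_exponent /=; lia.
- apply: etrans (key 1%N 1%N isT) _; apply/esym.
  apply: (@sum_rs_prod2
    (fun i r s => (r + s) ^ 2 + s ^ 2 + r + 2 * (i == 2) * s)%N 1 1 0 2).
  by move=> m n u v; rewrite /rs_exponent /=; lia.
Qed.
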